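(* Let $f$ be a closed fractal and $g$ any multivalued function between represented spaces. If $f \leq_W g \star \mathrm{C}_\mathbb{N}$, then $f \leq_W g$.
   Context: A represented space is $\mathbf{X}=(X,\delta_X)$ with $\delta_X:\subseteq\mathbb{N}^\mathbb{N}\to X$ a partial surjection. A realizer of $f:\subseteq\mathbf{X}\rightrightarrows\mathbf{Y}$ is a partial $F$ on Baire space with $\delta_YF(p)\in f(\delta_X(p))$ for all $p\in\operatorname{dom}(f\delta_X)$. $f\leq_W g$ iff there are computable partial $K,H$ on Baire space such that $p\mapsto K\langle p,G(H(p))\rangle$ realizes $f$ for every realizer $G$ of $g$. $f\star g:=\sup_{\leq_W}\{f'\circ g'\mid f'\leq_W f,\ g'\leq_W g\}$ (always exists). $\mathrm{C}_\mathbb{N}$ is closed choice on $\mathbb{N}$: given a non-empty $A\subseteq\mathbb{N}$ via an enumeration of $\mathbb{N}\setminus A$, output an element of $A$. For $A\subseteq\mathbb{N}^\mathbb{N}$, $\mathbf{X}_A:=(\delta_X[A],\delta_X|_A)$ and $f_A:\subseteq\mathbf{X}_A\rightrightarrows\mathbf{Y}$ is the induced map; $0$ is the degree of the nowhere defined function. $f$ is a closed fractal iff there is some $g:\mathbf{X}\rightrightarrows\mathbf{Y}$ with $\mathbf{X}\neq\emptyset$ and total representation $\delta_X:\mathbb{N}^\mathbb{N}\to X$ such that for every clopen $A\subseteq\mathbb{N}^\mathbb{N}$ either $g_A\equiv_W f$ or $g_A\equiv_W 0$. *)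

(* Defs.v *)
From Stdlib Require Import Arith List ProofIrrelevance FunctionalExtensionality.
Import ListNotations.

Definition Baire := nat -> nat.

Definition pfun := Baire -> option Baire.

Definition bpair (p q : Baire) : Baire :=
  fun n => if Nat.even n then p (Nat.div2 n) else q (Nat.div2 n).

(** * Partial recursive functions (mu-recursive, variable arity via lists,
      missing arguments default to 0). *)
Inductive recf : Type :=
| RZero : recf
| RSucc : recf
| RProj : nat -> recf
| RComp : recf -> list recf -> recf
| RPrec : recf -> recf -> recf
| RMin  : recf -> recf.

Inductive eval : recf -> list nat -> nat -> Prop :=
| evZero x : eval RZero x 0
| evSucc x : eval RSucc x (S (nth 0 x 0))
| evProj i x : eval (RProj i) x (nth i x 0)
| evComp f gs x ys y : evals gs x ys -> eval f ys y -> eval (RComp f gs) x y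
| evPrec0 g h x y : eval g x y -> eval (RPrec g h) (0 :: x) y
| evPrecS g h n x r y :
    eval (RPrec g h) (n :: x) r -> eval h (n :: r :: x) y ->
    eval (RPrec g h) (S n :: x) y
| evMin f x n (ks : nat -> nat) :
    eval f (n :: x) 0 ->
    (forall m, m < n -> eval f (m :: x) (S (ks m))) ->
    eval (RMin f) x n
with evals : list recf -> list nat -> list nat -> Prop :=
| evsNil x : evals nil x nil
| evsCons g gs x y ys : eval g x y -> evals gs x ys -> evals (g :: gs) x (y :: ys).

Definition total_recursive (a : nat -> nat) : Prop :=
  exists c : recf, forall n, eval c [n] (a n).

Definition cpair (n m : nat) : nat := (n + m) * (n + m + 1) / 2 + m.
Fixpoint code (l : list nat) : nat :=
  match l with nil => 0 | a :: l' => S (cpair a (code l')) end.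
Fixpoint prefix (p : Baire) (k : nat) : list nat :=
  match k with 0 => nil | S k' => prefix p k' ++ [p k'] end.

(** The partial continuous function determined by an associate [a]:
    output digit n on input p is v iff, for the least k with
    a <n, code(p|k)> > 0, that value is v+1. *)
Definition assoc_out (a : nat -> nat) (p : Baire) (n v : nat) : Prop :=
  exists k, (forall j, j < k -> a (cpair n (code (prefix p j))) = 0) /\
            a (cpair n (code (prefix p k))) = S v.
Definition assoc_computes (a : nat -> nat) (p q : Baire) : Prop :=
  forall n, assoc_out a p n (q n).

(** A partial function on Baire space is computable iff it is (a restriction
    of) the function computed by a type-2 machine, i.e. by a computable associate. *)
Definition computable_pf (K : pfun) : Prop :=
  exists a, total_recursive a /\
    forall p q, K p = Some q -> assoc_computes a p q.

Record rep_space := RepSpace {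
  carrier : Type;
  delta : Baire -> carrier -> Prop;
  delta_fun : forall p x y, delta p x -> delta p y -> x = y;
  delta_surj : forall x, exists p, delta p x }.

Definition mvf (X Y : rep_space) := carrier X -> carrier Y -> Prop.
Definition mdom {X Y : rep_space} (f : mvf X Y) (x : carrier X) : Prop :=
  exists y, f x y.

Definition realizer {X Y : rep_space} (f : mvf X Y) (F : pfun) : Prop :=
  forall p x, delta X p x -> mdom f x ->
    exists q y, F p = Some q /\ delta Y q y /\ f x y.

Definition W_le {X Y U V : rep_space} (f : mvf X Y) (g : mvf U V) : Prop :=
  exists K H : pfun, computable_pf K /\ computable_pf H /\
    forall G : pfun, realizer g G ->
      realizer f (fun p => match H p with
                           | Some r => match G r with
                                       | Some s => K (bpair p s)
                                       | None => None end
                           | None => None end).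

Definition W_equiv {X Y U V : rep_space} (f : mvf X Y) (g : mvf U V) : Prop :=
  W_le f g /\ W_le g f.

Definition mcomp {X Y Z : rep_space} (f : mvf Y Z) (g : mvf X Y) : mvf X Z :=
  fun x z => mdom g x /\ (forall y, g x y -> mdom f y) /\
             exists y, g x y /\ f y z.

(** [W_le_star h f g] : h ≤_W f ⋆ g, where
    f ⋆ g = sup_≤W { f' ∘ g' | f' ≤_W f, g' ≤_W g } (which always exists).
    Since the supremum exists, h ≤_W f ⋆ g iff h is below every ≤_W-upper
    bound of that set. *)
Definition W_le_star {X Y A B C D : rep_space}
    (h : mvf X Y) (f : mvf A B) (g : mvf C D) : Prop :=
  forall (U V : rep_space) (u : mvf U V),
    (forall (P Q R : rep_space) (f' : mvf Q R) (g' : mvf P Q),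
        W_le f' f -> W_le g' g -> W_le (mcomp f' g') u) ->
    W_le h u.

Definition nat_space : rep_space.
Proof.
  refine (@RepSpace nat (fun p n => p 0 = n) _ _).
  - intros p x y Hx Hy; congruence.
  - intros x; exists (fun _ => x); reflexivity.
Defined.

(** A(N): subsets of N (all closed), as characteristic functions, named by an
    enumeration of the complement (value k+1 enumerates k, 0 is a pause). *)
Definition closed_nat_space : rep_space.
Proof.
  refine (@RepSpace (nat -> bool)
            (fun p A => forall n, A n = false <-> exists k, p k = S n) _ _).
  - intros p A B HA HB. apply functional_extensionality; intro n.
    destruct (A n) eqn:E1, (B n) eqn:E2; auto.
    + apply HB in E2. apply HA in E2. congruence.
    + apply HA in E1. apply HB in E1. congruence.
  - intros A. exists (fun k => if A k then 0 else S k). intro n; split.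
    + intro H; exists n; rewrite H; reflexivity.
    + intros [k Hk]. destruct (A k) eqn:E; [discriminate|].
      injection Hk; intros; subst; assumption.
Defined.

Definition C_N : mvf closed_nat_space nat_space := fun A n => A n = true.

Definition open_set (A : Baire -> Prop) : Prop :=
  forall p, A p -> exists n, forall q, (forall i, i < n -> q i = p i) -> A q.
Definition clopen (A : Baire -> Prop) : Prop :=
  open_set A /\ open_set (fun p => ~ A p).

Definition restrict_space (X : rep_space) (A : Baire -> Prop) : rep_space.
Proof.
  refine (@RepSpace {x : carrier X | exists p, A p /\ delta X p x}
            (fun p x => A p /\ delta X p (proj1_sig x)) _ _).
  - intros p [x Hx] [y Hy] [_ H1] [_ H2]; simpl in *.
    pose proof (delta_fun X p x y H1 H2); subst y.
    f_equal; apply proof_irrelevance.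
  - intros [x [p [Hp Hx]]]. exists p; simpl; auto.
Defined.

Definition mrestrict {X Y : rep_space} (g : mvf X Y) (A : Baire -> Prop)
  : mvf (restrict_space X A) Y := fun x y => g (proj1_sig x) y.

(** A nowhere defined function (representative of the degree 0). *)
Definition nowhere : mvf nat_space nat_space := fun _ _ => False.

Definition closed_fractal {X Y : rep_space} (f : mvf X Y) : Prop :=
  exists (U V : rep_space) (g : mvf U V),
    (exists x : carrier U, True) /\
    (forall p, exists x, delta U p x) /\
    (forall x, mdom g x) /\
    forall A, clopen A ->
      W_equiv (mrestrict g A) f \/ W_equiv (mrestrict g A) nowhere.

(* Main.v *)
(** Let [h] be the total map on all of Baire space witnessing that [f] is a closed
    fractal; then [h] is equivalent to [f]. If [h] reduces to [g] after [C_N], each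
    [p] yields a non-empty closed set of naturals, so Baire space is covered by the
    countably many closed sets on which a fixed [n] is a correct choice. By the
    Baire category theorem one of them contains a cylinder. On it [C_N] can be
    answered by the constant [n], so [h] restricted to the cylinder reduces to [g];
    being non-empty, this restriction is equivalent to [f]. *)

Require Import Defs.
From Stdlib Require Import Arith Cantor Lia List FunctionalExtensionality ClassicalEpsilon.
Import ListNotations.

(** * Recursive functions *)

Definition recursive2 (f : nat -> nat -> nat) : Prop :=
  exists c, forall x y, eval c [x; y] (f x y).

(** [total_recursive] asks for a code of exactly the given function, so each closure proof picks a
    convenient shape and transfers it pointwise. *)
Lemma recursive_ext f g :
  (forall n, f n = g n) -> total_recursive f -> total_recursive g.
Proof. intros E [c Hc]; exists c; intro n; rewrite <- E; apply Hc. Qed.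

Lemma recursive_id : total_recursive (fun n => n).
Proof. exists (RProj 0); intro n; exact (evProj 0 [n]). Qed.

Lemma recursive_comp f g :
  total_recursive f -> total_recursive g -> total_recursive (fun n => f (g n)).
Proof.
  intros [cf Hf] [cg Hg]; exists (RComp cf [cg]); intro n.
  repeat econstructor; eauto.
Qed.

Lemma recursive_comp2 f g h :
  recursive2 f -> total_recursive g -> total_recursive h ->
  total_recursive (fun n => f (g n) (h n)).
Proof.
  intros [cf Hf] [cg Hg] [ch Hh]; exists (RComp cf [cg; ch]); intro n.
  repeat econstructor; eauto.
Qed.

Lemma recursive_succ : total_recursive S.
Proof. exists RSucc; intro n; exact (evSucc [n]). Qed.

Lemma recursive_const k : total_recursive (fun _ => k).
Proof.
  induction k as [|k IH].
  - exists RZero; intro; constructor.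
  - exact (recursive_comp S _ recursive_succ IH).
Qed.

Lemma recursive_pred : total_recursive pred.
Proof.
  exists (RPrec RZero (RProj 0)); intro n; induction n as [|n IH].
  - constructor; constructor.
  - econstructor; [exact IH | exact (evProj 0 _)].
Qed.

Lemma recursive_add : recursive2 Nat.add.
Proof.
  exists (RPrec (RProj 0) (RComp RSucc [RProj 1])); intros x y.
  induction x as [|x IH]; simpl.
  - constructor; exact (evProj 0 [y]).
  - econstructor; [exact IH | repeat econstructor].
Qed.

Lemma recursive_sub : recursive2 Nat.sub.
Proof.
  destruct recursive_pred as [cp Hp].
  exists (RComp (RPrec (RProj 0) (RComp cp [RProj 1])) [RProj 1; RProj 0]).
  intros x y; econstructor; [repeat econstructor|]; simpl.
  induction y as [|y IH].
  - rewrite Nat.sub_0_r; constructor; exact (evProj 0 [x]).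
  - econstructor; [exact IH | econstructor; [repeat econstructor|]].
    simpl; rewrite Nat.sub_succ_r; apply Hp.
Qed.

(** * The Cantor pairing and its inverse are recursive *)

Fixpoint triangle (n : nat) : nat :=
  match n with 0 => 0 | S n' => S n' + triangle n' end.

Lemma triangle_mono m n : m <= n -> triangle m <= triangle n.
Proof. induction 1; simpl; lia. Qed.

Lemma recursive_triangle : total_recursive triangle.
Proof.
  destruct recursive_add as [ca Ha].
  exists (RPrec RZero (RComp ca [RComp RSucc [RProj 0]; RProj 1])).
  intro n; induction n as [|n IH].
  - repeat constructor.
  - econstructor; [exact IH | econstructor; [repeat econstructor | apply Ha]].
Qed.

Lemma cpair_triangle n m : cpair n m = triangle (n + m) + m.
Proof.
  unfold cpair; f_equal; symmetry; apply Nat.div_unique_exact; [lia|].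
  induction (n + m) as [|k IH]; simpl in *; lia.
Qed.

(** Identifying [cpair] with the library's Cantor bijection makes [of_nat] available as its
    inverse. *)
Lemma cpair_to_nat n m : cpair n m = to_nat (n, m).
Proof.
  rewrite cpair_triangle; unfold to_nat; rewrite (Nat.add_comm n m), Nat.add_comm.
  f_equal; induction (m + n) as [|k IH]; simpl; congruence.
Qed.

Definition cfst (z : nat) : nat := fst (of_nat z).
Definition csnd (z : nat) : nat := snd (of_nat z).

Lemma cpair_eta z : cpair (cfst z) (csnd z) = z.
Proof.
  rewrite cpair_to_nat; unfold cfst, csnd; rewrite <- surjective_pairing.
  apply cancel_to_of.
Qed.

Lemma cfst_cpair n m : cfst (cpair n m) = n.
Proof. unfold cfst; rewrite cpair_to_nat, cancel_of_to; reflexivity. Qed.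

Lemma csnd_cpair n m : csnd (cpair n m) = m.
Proof. unfold csnd; rewrite cpair_to_nat, cancel_of_to; reflexivity. Qed.

Lemma cpair_ge_r n m : m <= cpair n m.
Proof. rewrite cpair_triangle; lia. Qed.

Lemma recursive_cpair : recursive2 cpair.
Proof.
  destruct recursive_add as [ca Ha], recursive_triangle as [ct Ht].
  exists (RComp ca [RComp ct [ca]; RProj 1]); intros x y; rewrite cpair_triangle.
  repeat econstructor; eauto.
Qed.

(* The diagonal of [z] is the least [d] with [z < triangle (S d)]. *)
Lemma recursive_diagonal : total_recursive (fun z => cfst z + csnd z).
Proof.
  destruct recursive_sub as [cs Hs], recursive_triangle as [ct Ht].
  exists (RMin (RComp cs [RComp RSucc [RProj 1]; RComp ct [RComp RSucc [RProj 0]]])).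
  intro z; pose proof (cpair_eta z) as E; rewrite cpair_triangle in E.
  assert (B : forall j,
    eval (RComp cs [RComp RSucc [RProj 1]; RComp ct [RComp RSucc [RProj 0]]])
         [j; z] (S z - triangle (S j))).
  { intro j; econstructor; [| apply Hs].
    repeat (econstructor; eauto). }
  (* Below the diagonal, [triangle (S j) <= z], so the truncated difference is positive and has this
     predecessor. *)
  apply evMin with (ks := fun j => z - triangle (S j)).
  - specialize (B (cfst z + csnd z)).
    replace (S z - triangle (S (cfst z + csnd z))) with 0 in B by (simpl; lia).
    exact B.
  - intros j Hj; pose proof (triangle_mono (S j) (cfst z + csnd z) Hj).
    replace (S (z - triangle (S j))) with (S z - triangle (S j)) by lia.
    apply B.
Qed.

Lemma recursive_csnd : total_recursive csnd.
Proof.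
  apply recursive_ext with (fun z => z - triangle (cfst z + csnd z)).
  - intro z; pose proof (cpair_eta z) as E; rewrite cpair_triangle in E; lia.
  - exact (recursive_comp2 _ _ _ recursive_sub recursive_id
      (recursive_comp _ _ recursive_triangle recursive_diagonal)).
Qed.

Lemma recursive_cfst : total_recursive cfst.
Proof.
  apply recursive_ext with (fun z => cfst z + csnd z - csnd z); [intro; lia|].
  exact (recursive_comp2 _ _ _ recursive_sub recursive_diagonal recursive_csnd).
Qed.

(** Stage, previous value and parameter are packed into one number, so that primitive recursion with
    a parameter needs only unary recursive functions. *)
Lemma recursive_nat_rect (g t : nat -> nat) (h : nat -> nat -> nat -> nat) :
  total_recursive g -> total_recursive t ->
  total_recursive (fun m => h (cfst m) (cfst (csnd m)) (csnd (csnd m))) ->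
  total_recursive (fun m => nat_rect (fun _ => nat) (g m) (fun j r => h j r m) (t m)).
Proof.
  intros [cg Hg] [ct Ht] [ch Hh]; destruct recursive_cpair as [cc Hc].
  exists (RComp (RPrec cg (RComp ch
    [RComp cc [RProj 0; RComp cc [RProj 1; RProj 2]]])) [ct; RProj 0]).
  intro m; econstructor; [repeat (econstructor; eauto)|]; simpl.
  induction (t m) as [|j IH]; simpl.
  - constructor; apply Hg.
  - econstructor; [exact IH|]; econstructor; [repeat (econstructor; eauto)|].
    simpl nth; match goal with |- eval _ [cpair j (cpair ?r m)] _ =>
      specialize (Hh (cpair j (cpair r m))) end.
    cbv beta in Hh; rewrite ?csnd_cpair, ?cfst_cpair in Hh; exact Hh.
Qed.

(** A case distinction is a recursion that ignores its previous value. *)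
Lemma recursive_match (f g : nat -> nat) (h : nat -> nat -> nat) :
  total_recursive f -> total_recursive g ->
  total_recursive (fun m => h (cfst m) (csnd m)) ->
  total_recursive (fun m => match f m with 0 => g m | S k => h k m end).
Proof.
  intros Hf Hg Hh.
  apply recursive_ext with
    (fun m => nat_rect (fun _ => nat) (g m) (fun j _ => h j m) (f m)).
  - intro m; destruct (f m); reflexivity.
  - apply (recursive_nat_rect g f (fun j _ m => h j m)); auto.
    eapply recursive_ext; [| exact (recursive_comp _ _ Hh
      (recursive_comp2 _ _ _ recursive_cpair recursive_cfst
        (recursive_comp _ _ recursive_csnd recursive_csnd)))].
    intro n; cbv beta; rewrite csnd_cpair, cfst_cpair; reflexivity.
Qed.

Ltac solve_recursive :=
  repeat (cbv beta; first
    [ assumption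
    | exact recursive_id | apply recursive_const
    | exact recursive_cfst | exact recursive_csnd
    | match goal with
      | |- total_recursive (fun m => S (@?f m)) =>
          apply (recursive_comp S f recursive_succ)
      | |- total_recursive (fun m => pred (@?f m)) =>
          apply (recursive_comp pred f recursive_pred)
      | |- total_recursive (fun m => cfst (@?f m)) =>
          apply (recursive_comp cfst f recursive_cfst)
      | |- total_recursive (fun m => csnd (@?f m)) =>
          apply (recursive_comp csnd f recursive_csnd)
      | |- total_recursive (fun m => cpair (@?f m) (@?g m)) =>
          apply (recursive_comp2 cpair f g recursive_cpair)
      | |- total_recursive (fun m => Nat.add (@?f m) (@?g m)) =>
          apply (recursive_comp2 Nat.add f g recursive_add)
      | |- total_recursive (fun m => Nat.sub (@?f m) (@?g m)) =>
          apply (recursive_comp2 Nat.sub f g recursive_sub)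
      | H : total_recursive ?h |- total_recursive (fun m => ?h (@?f m)) =>
          apply (recursive_comp h f H)
      | |- total_recursive (fun m => nat_rect _ (@?g m) (fun j r => @?h j r m) (@?t m)) =>
          apply (recursive_nat_rect g t h)
      | |- total_recursive (fun m => match @?f m with 0 => @?g m | S k => @?h k m end) =>
          apply (recursive_match f g h)
      end ]).

(** * Parity and halving, used to interleave sequences *)

Definition even_bit (n : nat) : nat := if Nat.even n then 1 else 0.

Lemma even_bit_succ n : even_bit (S n) = 1 - even_bit n.
Proof.
  unfold even_bit; rewrite Nat.even_succ, <- Nat.negb_even.
  destruct (Nat.even n); reflexivity.
Qed.

Lemma recursive_even_bit : total_recursive even_bit.
Proof.
  apply recursive_ext with
    (fun n => nat_rect (fun _ => nat) 1 (fun _ r => 1 - r) n); [|solve_recursive].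
  intro n; induction n as [|n IH]; [reflexivity|].
  rewrite even_bit_succ, <- IH; reflexivity.
Qed.

Lemma div2_succ n : Nat.div2 (S n) = Nat.div2 n + (1 - even_bit n).
Proof.
  (* [Nat.div2] consumes two successors at a time, so two consecutive instances are proved
     together. *)
  assert (H : Nat.div2 (S n) = Nat.div2 n + (1 - even_bit n) /\
    Nat.div2 (S (S n)) = Nat.div2 (S n) + (1 - even_bit (S n))); [|apply H].
  induction n as [|n [IH1 IH2]]; [split; reflexivity|].
  split; [exact IH2|]; simpl Nat.div2 in *; rewrite !even_bit_succ.
  unfold even_bit in *; destruct (Nat.even n); simpl in *; lia.
Qed.

Lemma recursive_div2 : total_recursive Nat.div2.
Proof.
  pose proof recursive_even_bit as He.
  apply recursive_ext with (fun n =>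
    nat_rect (fun _ => nat) 0 (fun j r => r + (1 - even_bit j)) n); [|solve_recursive].
  intro n; induction n as [|n IH]; [reflexivity|].
  rewrite div2_succ, <- IH; reflexivity.
Qed.

(** * Approximating partial functions from prefixes *)

Definition agree (k : nat) (p q : Baire) : Prop := forall i, i < k -> p i = q i.

Lemma prefix_map p k : prefix p k = map p (seq 0 k).
Proof.
  induction k as [|k IH]; [reflexivity|].
  rewrite seq_S, map_app; simpl; congruence.
Qed.

Lemma prefix_agree k p q : agree k p q -> prefix p k = prefix q k.
Proof.
  intro H; rewrite !prefix_map; apply map_ext_in.
  intros i Hi; apply in_seq in Hi; apply H; lia.
Qed.

(** This lets the code of the prefix double as a bound on the length of a search. *)
Lemma code_prefix_ge p k : k <= code (prefix p k).
Proof.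
  assert (H : forall l, length l <= code l).
  { induction l as [|a l IH]; [apply le_n|].
    change (S (length l) <= S (cpair a (code l))).
    pose proof (cpair_ge_r a (code l)); lia. }
  specialize (H (prefix p k)); rewrite prefix_map in *.
  rewrite length_map, length_seq in H; exact H.
Qed.

Lemma assoc_out_functional a p n v w :
  assoc_out a p n v -> assoc_out a p n w -> v = w.
Proof.
  intros [k [Hk Ek]] [j [Hj Ej]].
  destruct (Nat.lt_trichotomy k j) as [L|[->|L]].
  - rewrite Hj in Ek; congruence.
  - congruence.
  - rewrite Hk in Ej; congruence.
Qed.

Lemma assoc_computes_functional a p q r :
  assoc_computes a p q -> assoc_computes a p r -> q = r.
Proof.
  intros Hq Hr; extensionality n.
  exact (assoc_out_functional _ _ _ _ _ (Hq n) (Hr n)).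
Qed.

Lemma assoc_out_continuous a p n v :
  assoc_out a p n v -> exists k, forall q, agree k q p -> assoc_out a q n v.
Proof.
  intros [k [Hk Ek]]; exists k; intros q Hq; exists k; split.
  - intros j Hj; rewrite (prefix_agree j q p); auto.
    intros i Hi; apply Hq; lia.
  - rewrite (prefix_agree k q p); auto.
Qed.

(* [l w i] is the digit [i] of the output as far as the prefix coded by [w]
   determines it: [0] for unknown, [S v] for the digit [v]. *)
Definition approx (p : Baire) (l : nat -> nat -> nat) (q : Baire) : Prop :=
  (forall k i, l (code (prefix p k)) i = 0 \/ l (code (prefix p k)) i = S (q i)) /\
  (forall i, exists k0, forall k, k0 <= k -> l (code (prefix p k)) i = S (q i)).

(** The digit index comes first and the prefix code second, as in [assoc_out]; the packed function
    is thus itself an associate. *)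
Definition recursive_approx (l : nat -> nat -> nat) : Prop :=
  total_recursive (fun m => l (csnd m) (cfst m)).

Lemma recursive_approx_comp l f g :
  recursive_approx l -> total_recursive f -> total_recursive g ->
  total_recursive (fun m => l (f m) (g m)).
Proof.
  intros Hl Hf Hg.
  eapply recursive_ext;
    [| exact (recursive_comp _ _ Hl (recursive_comp2 _ _ _ recursive_cpair Hg Hf))].
  intro n; cbv beta; rewrite csnd_cpair, cfst_cpair; reflexivity.
Qed.

Definition approximable (F : pfun) : Prop :=
  exists l, recursive_approx l /\ forall p q, F p = Some q -> approx p l q.

(** An approximation never states a wrong digit, so its first nonzero value is the right one, which
    is what an associate must deliver. *)
Lemma approximable_computable F : approximable F -> computable_pf F.
Proof.
  intros [l [Hl HF]]; exists (fun m => l (csnd m) (cfst m)); split; [exact Hl|].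
  intros p q E n; destruct (HF p q E) as [Hs Hc]; clear E.
  destruct (Hc n) as [k0 Hk0]; specialize (Hk0 k0 (le_n _)); clear Hc.
  assert (L : exists k, (forall j, j < k -> l (code (prefix p j)) n = 0) /\
                        l (code (prefix p k)) n = S (q n)).
  { induction k0 as [k IH] using lt_wf_ind.
    destruct (classic (exists j, j < k /\ l (code (prefix p j)) n <> 0))
      as [[j [Hj N]]|N].
    - apply (IH j Hj); destruct (Hs j n); congruence.
    - exists k; split; [|exact Hk0]; intros j Hj.
      destruct (Nat.eq_dec (l (code (prefix p j)) n) 0); eauto; exfalso; eauto. }
  destruct L as [k [H1 H2]]; exists k; rewrite csnd_cpair, cfst_cpair.
  split; [|exact H2]; intros j Hj; rewrite csnd_cpair, cfst_cpair; auto.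
Qed.

(** [csnd (pred r)] is the code of the tail. It fixes 0, so dropping past the end yields the empty
    list. *)
Definition drop_code (i w : nat) : nat :=
  nat_rect (fun _ => nat) w (fun _ r => csnd (pred r)) i.

Definition lookup (w i : nat) : nat :=
  match drop_code i w with 0 => 0 | S c => S (cfst c) end.

Lemma lookup_approx p : approx p lookup p.
Proof.
  assert (D : forall i l, drop_code i (code l) = code (skipn i l)).
  { intros i l; induction i as [|i IH]; [reflexivity|].
    change (drop_code (S i) (code l)) with (csnd (pred (drop_code i (code l)))).
    rewrite IH, <- (Nat.add_1_l i), <- skipn_skipn.
    destruct (skipn i l) as [|a l']; [reflexivity|].
    change (csnd (cpair a (code l')) = code l'); apply csnd_cpair. }
  assert (L : forall k i, lookup (code (prefix p k)) i = if i <? k then S (p i) else 0).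
  { intros k i; unfold lookup; rewrite D, prefix_map, skipn_map, skipn_seq.
    destruct (Nat.ltb_spec i k) as [H|H].
    - replace (k - i) with (S (k - i - 1)) by lia.
      change (S (cfst (cpair (p (0 + i))
        (code (map p (seq (S (0 + i)) (k - i - 1)))))) = S (p i)).
      rewrite cfst_cpair; reflexivity.
    - replace (k - i) with 0 by lia; reflexivity. }
  split.
  - intros k i; rewrite L; destruct (i <? k); auto.
  - intro i; exists (S i); intros k Hk; rewrite L.
    destruct (Nat.ltb_spec i k); [reflexivity|lia].
Qed.

Lemma recursive_lookup : recursive_approx lookup.
Proof. unfold recursive_approx, lookup, drop_code; solve_recursive. Qed.

(* Built from the back, since [code] is a cons-list encoding. *)
Definition digits_code (l : nat -> nat) (j : nat) : nat :=
  nat_rect (fun _ => nat) 0 (fun t r => S (cpair (pred (l (j - S t))) r)) j.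

Lemma digits_code_spec l q j :
  (forall i, i < j -> l i = S (q i)) -> digits_code l j = code (prefix q j).
Proof.
  intro H; unfold digits_code; rewrite prefix_map.
  assert (G : forall t, t <= j ->
    nat_rect (fun _ => nat) 0 (fun t r => S (cpair (pred (l (j - S t))) r)) t =
    code (map q (seq (j - t) t))).
  { induction t as [|t IH]; intro Ht; [reflexivity|].
    cbn [nat_rect]; rewrite IH by lia.
    rewrite H by lia; replace (j - t) with (S (j - S t)) by lia.
    reflexivity. }
  rewrite G by apply le_n; rewrite Nat.sub_diag; reflexivity.
Qed.

(* Searches for the least [j] at which the associate approximated by [b] answers
   on the first [j] digits approximated by [l]. The state is [0] once a required
   value is unknown, [1] while the search goes on, and [S (S v)] once the answer
   [v] is found. *)
Definition search (b l : nat -> nat) (n j : nat) : nat :=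
  nat_rect (fun _ => nat) (b (cpair n 0))
    (fun i r => match r with
       | 0 => 0
       | S r' => match r' with
           | 0 => match l i with
               | 0 => 0
               | S _ => b (cpair n (digits_code l (S i))) end
           | S _ => r end end) j.

(** The prefix code [w] serves both as data and as the number of search steps. [pred] turns the
    states 0 and 1 into an unknown digit and [S (S v)] into the known digit [v]. *)
Definition apply_approx (b l : nat -> nat -> nat) (w n : nat) : nat :=
  pred (search (b w) (l w) n w).

Lemma recursive_apply_approx b l :
  recursive_approx b -> recursive_approx l -> recursive_approx (apply_approx b l).
Proof.
  intros Hb Hl; unfold recursive_approx, apply_approx, search, digits_code.
  repeat (solve_recursive; match goal with
    | |- total_recursive (fun m => l (@?f m) (@?g m)) =>
        apply (recursive_approx_comp l f g Hl)
    | |- total_recursive (fun m => b (@?f m) (@?g m)) =>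
        apply (recursive_approx_comp b f g Hb)
    end).
Qed.

(** [K] is the stage at which the true associate [B] answers on [q]. The search halts at an unknown
    value instead of skipping it, so it can neither miss [K] nor accept another answer. *)
Lemma search_sound (B q : Baire) b l n v K j :
  (forall i, b i = 0 \/ b i = S (B i)) -> (forall i, l i = 0 \/ l i = S (q i)) ->
  (forall j, j < K -> B (cpair n (code (prefix q j))) = 0) ->
  B (cpair n (code (prefix q K))) = S v ->
  search b l n j = 0 \/
  (search b l n j = 1 /\ j < K /\ forall i, i < j -> l i = S (q i)) \/
  search b l n j = S (S v).
Proof.
  intros Hb Hl HK EK.
  assert (Q : forall j, j <= K -> b (cpair n (code (prefix q j))) = 0 \/
     b (cpair n (code (prefix q j))) = 1 /\ j < K \/
     b (cpair n (code (prefix q j))) = S (S v)).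
  { intros i Hi; destruct (Hb (cpair n (code (prefix q i)))) as [E|E]; [auto|].
    destruct (Nat.eq_dec i K) as [->|N]; [rewrite E, EK; auto|].
    rewrite E, HK by lia; right; left; split; [reflexivity|lia]. }
  induction j as [|j IH].
  - change (search b l n 0) with (b (cpair n (code (prefix q 0)))).
    destruct (Q 0 (Nat.le_0_l _)) as [E|[[E L]|E]]; auto.
    right; left; split; [exact E|]; split; [exact L|]; intros i Hi; lia.
  - unfold search; cbn [nat_rect]; fold (search b l n j).
    destruct IH as [E|[[E [L A]]|E]]; rewrite E; auto.
    destruct (Hl j) as [Z|Z]; rewrite Z; auto.
    assert (A' : forall i, i < S j -> l i = S (q i)).
    { intros i Hi; destruct (Nat.eq_dec i j) as [->|]; [exact Z|apply A; lia]. }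
    rewrite (digits_code_spec l q (S j) A').
    destruct (Q (S j) L) as [E'|[[E' L']|E']]; auto.
Qed.

(** Only the values of [B] on prefixes up to length [K] and the first [K] digits of [q] are
    consulted; once they are known the search cannot get stuck. *)
Lemma search_complete (B q : Baire) b l n v K j :
  (forall i, i <= K -> b (cpair n (code (prefix q i))) =
                       S (B (cpair n (code (prefix q i))))) ->
  (forall i, i < K -> l i = S (q i)) ->
  (forall j, j < K -> B (cpair n (code (prefix q j))) = 0) ->
  B (cpair n (code (prefix q K))) = S v ->
  (j < K -> search b l n j = 1) /\ (K <= j -> search b l n j = S (S v)).
Proof.
  intros Hb Hl HK EK; induction j as [|j [IH1 IH2]].
  - change (search b l n 0) with (b (cpair n (code (prefix q 0)))).
    split; intro H; rewrite Hb by lia.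
    + rewrite HK by exact H; reflexivity.
    + replace K with 0 in EK by lia; rewrite EK; reflexivity.
  - unfold search; cbn [nat_rect]; fold (search b l n j).
    destruct (Nat.lt_ge_cases j K) as [L|L].
    + rewrite IH1, Hl by exact L.
      rewrite (digits_code_spec l q (S j)) by (intros i Hi; apply Hl; lia).
      rewrite Hb by lia; split; intro H.
      * rewrite HK by exact H; reflexivity.
      * replace K with (S j) in EK by lia; rewrite EK; reflexivity.
    + rewrite IH2 by exact L; split; [lia|reflexivity].
Qed.

Lemma eventually_all (P : nat -> nat -> Prop) K :
  (forall i, exists k0, forall k, k0 <= k -> P k i) ->
  exists k0, forall k, k0 <= k -> forall i, i < K -> P k i.
Proof.
  intro H; induction K as [|K [k1 IH]]; [exists 0; intros; lia|].
  destruct (H K) as [k2 H2]; exists (k1 + k2); intros k Hk i Hi.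
  destruct (Nat.eq_dec i K) as [->|]; [apply H2|apply IH]; lia.
Qed.

Lemma approx_apply p b l B q r :
  approx p b B -> approx p l q -> assoc_computes B q r ->
  approx p (apply_approx b l) r.
Proof.
  intros [Sb Cb] [Sl Cl] HB; unfold apply_approx; split.
  - intros k n; destruct (HB n) as [K [HK EK]].
    destruct (search_sound B q _ _ n (r n) K (code (prefix p k)) (Sb k) (Sl k) HK EK)
      as [E|[[E _]|E]]; rewrite E; auto.
  - intro n; destruct (HB n) as [K [HK EK]].
    destruct (eventually_all _ K Cl) as [k1 H1].
    destruct (eventually_all (fun k i => b (code (prefix p k)) (cpair n (code (prefix q i)))
        = S (B (cpair n (code (prefix q i))))) (S K) (fun i => Cb _)) as [k2 H2].
    (* [k1] and [k2] make the finitely many consulted values known; [K] ensures, via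
       [code_prefix_ge], that the search runs long enough. *)
    exists (K + k1 + k2); intros k Hk.
    pose proof (code_prefix_ge p k) as G.
    destruct (search_complete B q (b (code (prefix p k))) (l (code (prefix p k))) n (r n) K
      (code (prefix p k))) as [_ E]; auto.
    + intros i Hi; apply (H2 k); lia.
    + intros i Hi; apply (H1 k); lia.
    + rewrite E by lia; reflexivity.
Qed.

(** The associate may itself depend on the input. Composition is the case of a constant
    associate. *)
Lemma approximable_apply (F G K : pfun) :
  approximable F -> approximable G ->
  (forall p r, K p = Some r -> exists B q,
     F p = Some B /\ G p = Some q /\ assoc_computes B q r) ->
  approximable K.
Proof.
  intros [b [Rb Hb]] [l [Rl Hl]] HK.
  exists (apply_approx b l); split; [apply recursive_apply_approx; assumption|].
  intros p r E; destruct (HK p r E) as [B [q [EF [EG HB]]]].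
  eapply approx_apply; eauto.
Qed.

Lemma approximable_const a : total_recursive a -> approximable (fun _ => Some a).
Proof.
  intro Ha; exists (fun _ i => S (a i)); split.
  - unfold recursive_approx; solve_recursive.
  - intros p q E; injection E as <-; split; [auto|].
    intro i; exists 0; reflexivity.
Qed.

Lemma approximable_reindex phi :
  total_recursive phi -> approximable (fun p => Some (fun n => p (phi n))).
Proof.
  intro H; exists (fun w i => lookup w (phi i)); split.
  - apply (recursive_approx_comp lookup csnd (fun m => phi (cfst m)) recursive_lookup);
      solve_recursive.
  - intros p q E; injection E as <-; destruct (lookup_approx p) as [S1 S2].
    split; intros; auto.
Qed.

(** [F] is a constant recursive associate applied to the identity. *)
Lemma computable_approximable F : computable_pf F -> approximable F.
Proof.
  intros [a [Ha HF]].
  apply (approximable_apply _ _ _ (approximable_const a Ha)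
    (approximable_reindex (fun n => n) recursive_id)).
  intros p r E; exists a, p; auto.
Qed.

(** * Computable partial functions on Baire space *)

Definition pbind (F G : pfun) : pfun :=
  fun p => match F p with Some q => G q | None => None end.

Definition ppair (F G : pfun) : pfun :=
  fun p => match F p, G p with
           | Some q, Some r => Some (bpair q r)
           | _, _ => None end.

(** Application in Kleene's second algebra; the chosen [r] is unique by
    [assoc_computes_functional]. *)
Definition papply (F G : pfun) : pfun :=
  fun p => match F p, G p with
           | Some a, Some q =>
               match excluded_middle_informative (exists r, assoc_computes a q r) with
               | left e => Some (proj1_sig (constructive_indefinite_description _ e))
               | right _ => None end
           | _, _ => None end.

Definition bfst (p : Baire) : Baire := fun n => p (2 * n).
Definition bsnd (p : Baire) : Baire := fun n => p (2 * n + 1).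

Definition pfst : pfun := fun p => Some (bfst p).
Definition psnd : pfun := fun p => Some (bsnd p).

Lemma bfst_bpair p q : bfst (bpair p q) = p.
Proof.
  extensionality n; unfold bfst, bpair.
  rewrite Nat.even_even, Nat.div2_double; reflexivity.
Qed.

Lemma bsnd_bpair p q : bsnd (bpair p q) = q.
Proof.
  extensionality n; unfold bsnd, bpair.
  rewrite Nat.even_odd, Nat.add_1_r, Nat.div2_succ_double; reflexivity.
Qed.

Lemma papply_intro F G p a q r :
  F p = Some a -> G p = Some q -> assoc_computes a q r -> papply F G p = Some r.
Proof.
  intros EF EG H; unfold papply; rewrite EF, EG.
  destruct (excluded_middle_informative _) as [e|N]; [|exfalso; eauto].
  destruct (constructive_indefinite_description _ e) as [r' H']; simpl; f_equal.
  exact (assoc_computes_functional _ _ _ _ H' H).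
Qed.

Lemma papply_elim F G p r :
  papply F G p = Some r ->
  exists a q, F p = Some a /\ G p = Some q /\ assoc_computes a q r.
Proof.
  unfold papply; destruct (F p) as [a|]; [|discriminate].
  destruct (G p) as [q|]; [|discriminate].
  destruct (excluded_middle_informative _) as [e|N]; [|discriminate].
  destruct (constructive_indefinite_description _ e) as [r' H']; simpl.
  intro E; injection E as <-; eauto.
Qed.

Lemma computable_papply F G :
  computable_pf F -> computable_pf G -> computable_pf (papply F G).
Proof.
  intros HF HG; apply approximable_computable.
  apply (approximable_apply F G); auto using computable_approximable.
  apply papply_elim.
Qed.

Lemma computable_pbind F G :
  computable_pf F -> computable_pf G -> computable_pf (pbind F G).
Proof.
  intros HF [a [Ha HG]]; apply approximable_computable.
  apply (approximable_apply (fun _ => Some a) F);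
    auto using computable_approximable, approximable_const.
  unfold pbind; intros p r E; destruct (F p) as [q|]; [|discriminate].
  exists a, q; auto.
Qed.

Lemma computable_ppair F G :
  computable_pf F -> computable_pf G -> computable_pf (ppair F G).
Proof.
  intros HF HG; apply approximable_computable.
  destruct (computable_approximable F HF) as [l [Rl Hl]].
  destruct (computable_approximable G HG) as [m [Rm Hm]].
  exists (fun w n => match even_bit n with
                     | 0 => m w (Nat.div2 n) | S _ => l w (Nat.div2 n) end); split.
  - pose proof recursive_even_bit; pose proof recursive_div2.
    unfold recursive_approx; apply (recursive_match (fun x => even_bit (cfst x))
      (fun x => m (csnd x) (Nat.div2 (cfst x)))
      (fun _ x => l (csnd x) (Nat.div2 (cfst x)))).
    + solve_recursive.
    + apply (recursive_approx_comp m csnd (fun x => Nat.div2 (cfst x)) Rm); solve_recursive.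
    + apply (recursive_approx_comp l (fun x => csnd (csnd x))
        (fun x => Nat.div2 (cfst (csnd x))) Rl); solve_recursive.
  - intros p q E; unfold ppair in E.
    destruct (F p) as [q1|] eqn:E1; [|discriminate].
    destruct (G p) as [q2|] eqn:E2; [|discriminate].
    injection E as <-; apply Hl in E1; apply Hm in E2.
    destruct E1 as [S1 C1], E2 as [S2 C2]; unfold bpair, even_bit; split.
    + intros k i; destruct (Nat.even i); auto.
    + intro i; destruct (Nat.even i); auto.
Qed.

Lemma computable_const a : total_recursive a -> computable_pf (fun _ => Some a).
Proof. intro H; apply approximable_computable, approximable_const, H. Qed.

Lemma computable_id : computable_pf (fun p => Some p).
Proof.
  apply approximable_computable.
  exact (approximable_reindex (fun n => n) recursive_id).
Qed.

Lemma computable_pfst : computable_pf pfst.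
Proof.
  (* This is [2 * n] up to conversion, written with the addition that [solve_recursive] can
     handle. *)
  apply approximable_computable; refine (approximable_reindex (fun n => n + (n + 0)) _).
  solve_recursive.
Qed.

Lemma computable_psnd : computable_pf psnd.
Proof.
  apply approximable_computable; refine (approximable_reindex (fun n => n + (n + 0) + 1) _).
  solve_recursive.
Qed.

Create HintDb computable.
#[local] Hint Resolve computable_pbind computable_ppair computable_papply computable_id
  computable_pfst computable_psnd computable_const recursive_const : computable.

(** * Weihrauch reducibility without realizers *)

Definition reduces_via {X Y U V : rep_space} (f : mvf X Y) (g : mvf U V)
    (K H : pfun) : Prop :=
  forall p x, delta X p x -> mdom f x ->
    exists r u, H p = Some r /\ delta U r u /\ mdom g u /\
      forall s v, delta V s v -> g u v ->
        exists q y, K (bpair p s) = Some q /\ delta Y q y /\ f x y.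

Definition answer {U V : rep_space} (g : mvf U V) (r s : Baire) : Prop :=
  exists u v, delta U r u /\ delta V s v /\ g u v.

Definition choice_realizer {U V : rep_space} (g : mvf U V) : pfun :=
  fun r => match excluded_middle_informative (exists s, answer g r s) with
           | left e => Some (proj1_sig (constructive_indefinite_description _ e))
           | right _ => None end.

Lemma choice_realizer_elim {U V : rep_space} (g : mvf U V) r s :
  choice_realizer g r = Some s -> answer g r s.
Proof.
  unfold choice_realizer; destruct (excluded_middle_informative _) as [e|]; [|discriminate].
  destruct (constructive_indefinite_description _ e) as [s' H]; simpl.
  intro E; injection E as <-; exact H.
Qed.

Lemma choice_realizer_spec {U V : rep_space} (g : mvf U V) :
  realizer g (choice_realizer g).
Proof.
  intros r u Hu [v Hv].
  destruct (choice_realizer g r) as [s|] eqn:E.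
  - destruct (choice_realizer_elim g r s E) as [u' [v' [Hu' [Hv' G]]]].
    rewrite (delta_fun U r u u' Hu Hu'); eauto.
  - exfalso; destruct (delta_surj V v) as [s Hs]; unfold choice_realizer in E.
    destruct (excluded_middle_informative _) as [e|N]; [discriminate|].
    apply N; exists s, u, v; auto.
Qed.

Lemma W_le_iff {X Y U V : rep_space} (f : mvf X Y) (g : mvf U V) :
  W_le f g <->
  exists K H, computable_pf K /\ computable_pf H /\ reduces_via f g K H.
Proof.
  split; intros [K [H [CK [CH R]]]]; exists K, H; do 2 (split; [assumption|]).
  - intros p x Hx Dx.
    (* The choice realizer has values only at names of points in the domain of [g], so having one at
       [H p] shows that [H p] is such a name. *)
    destruct (R _ (choice_realizer_spec g) p x Hx Dx) as [q0 [y0 [E _]]].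
    destruct (H p) as [r|] eqn:EH; [|discriminate].
    destruct (choice_realizer g r) as [s0|] eqn:E0; [|discriminate].
    destruct (choice_realizer_elim g r s0 E0) as [u [v0 [Hu [_ G0]]]].
    exists r, u; repeat (split; [solve [eauto | eexists; eauto]|]).
    intros s v Hv G.
    (* A realizer may be altered at the single name [r], so every solution occurs. *)
    set (F := fun r' => if excluded_middle_informative (r' = r)
                        then Some s else choice_realizer g r').
    assert (HF : realizer g F).
    { intros r' u' Hu' Du'; unfold F.
      destruct (excluded_middle_informative (r' = r)) as [->|N].
      - rewrite <- (delta_fun U r u u' Hu Hu'); eauto.
      - exact (choice_realizer_spec g r' u' Hu' Du'). }
    destruct (R F HF p x Hx Dx) as [q [y [E' [Hy Fy]]]].
    rewrite EH in E'; unfold F in E'.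
    destruct (excluded_middle_informative (r = r)) as [_|N]; [|congruence].
    eauto.
  - intros G HG p x Hx Dx.
    destruct (R p x Hx Dx) as [r [u [EH [Hu [Du A]]]]].
    destruct (HG r u Hu Du) as [s [v [EG [Hv Gv]]]].
    rewrite EH, EG; eauto.
Qed.

Lemma W_le_trans {X Y U V S T : rep_space} (f : mvf X Y) (g : mvf U V) (h : mvf S T) :
  W_le f g -> W_le g h -> W_le f h.
Proof.
  rewrite !W_le_iff; intros [K1 [H1 [CK1 [CH1 R1]]]] [K2 [H2 [CK2 [CH2 R2]]]].
  (* From [<p, s>], the inner query [H1 p] is recomputed, [K2] answers it with the help of [s], and
     [K1] combines this answer with [p]. *)
  exists (pbind (ppair pfst
                  (pbind (ppair (pbind pfst H1) psnd) K2)) K1),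
    (pbind H1 H2).
  split; [|split].
  - auto 10 with computable.
  - auto with computable.
  - intros p x Hx Dx.
    destruct (R1 p x Hx Dx) as [r [u [E1 [Hu [Du A1]]]]].
    destruct (R2 r u Hu Du) as [r' [u' [E2 [Hu' [Du' A2]]]]].
    exists r', u'; unfold pbind, ppair, pfst, psnd; rewrite E1; repeat (split; [assumption|]).
    intros s v Hv Gv; rewrite bfst_bpair, bsnd_bpair, E1.
    destruct (A2 s v Hv Gv) as [q [y [E3 [Hy Fy]]]]; rewrite E3.
    exact (A1 q y Hy Fy).
Qed.

(** * A concrete upper bound for the compositions with [C_N] *)

Definition baire_space : rep_space.
Proof.
  refine (@RepSpace Baire (fun p q => p = q) _ _); [congruence | eauto].
Defined.

Definition avoids (e : Baire) (n : nat) : Prop := forall k, e k <> S n.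

(* An instance is [<<e, p>, a>]: the enumeration [e] of the complement of a set
   [A], a parameter [p], and an associate [a] that turns [<p, t>] into a name of
   an instance of [g] whenever [t 0] is in [A]. A solution is a pair [<t, s>]. *)
Definition star_instance {U V : rep_space} (g : mvf U V) (e p a : Baire) : Prop :=
  (exists n, avoids e n) /\
  forall t, avoids e (t 0) -> exists r u,
    assoc_computes a (bpair p t) r /\ delta U r u /\ mdom g u.

Definition star_C_N {U V : rep_space} (g : mvf U V) : mvf baire_space baire_space :=
  fun z w => exists e p a t s r,
    z = bpair (bpair e p) a /\ w = bpair t s /\ star_instance g e p a /\
    avoids e (t 0) /\ assoc_computes a (bpair p t) r /\ answer g r s.

Lemma star_C_N_dom {U V : rep_space} (g : mvf U V) e p a :
  star_instance g e p a -> mdom (star_C_N g) (bpair (bpair e p) a).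
Proof.
  intro I; pose proof I as [[n Hn] Ht].
  destruct (Ht (fun _ => n) Hn) as [r [u [Hr [Hu [v Hv]]]]].
  destruct (delta_surj V v) as [s Hs].
  exists (bpair (fun _ => n) s), e, p, a, (fun _ => n), s, r.
  repeat (split; [solve [auto]|]); exists u, v; auto.
Qed.

(** [W_le_star] speaks of all upper bounds, so exhibiting this one suffices to use it. The instance
    for [p] is [<<H2 p, p>, a>] with [a] an associate of [H1] after [K2]. The solution keeps the
    choice [t], from which [K2] is rerun before [K1] is applied. *)
Lemma star_C_N_upper_bound {U V : rep_space} (g : mvf U V) (P Q R : rep_space)
    (f' : mvf Q R) (g' : mvf P Q) :
  W_le f' g -> W_le g' C_N -> W_le (mcomp f' g') (star_C_N g).
Proof.
  rewrite !W_le_iff; intros [K1 [H1 [CK1 [CH1 R1]]]] [K2 [H2 [CK2 [CH2 R2]]]].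
  destruct (computable_pbind K2 H1 CK2 CH1) as [a [Ra Ha]].
  exists (pbind (ppair (pbind (ppair pfst
                                     (pbind psnd pfst)) K2)
                       (pbind psnd psnd)) K1),
    (ppair (ppair H2 (fun p => Some p)) (fun _ => Some a)).
  split; [|split].
  - auto 10 with computable.
  - auto with computable.
  - intros p x Hx [z [Dx [Df _]]].
    destruct (R2 p x Hx Dx) as [e [A [E2 [HA [[n0 Hn0] A2]]]]].
    assert (Av : forall n, avoids e n <-> A n = true).
    { intro n; specialize (HA n); split; intro H.
      - destruct (A n); [reflexivity|]; destruct (proj1 HA eq_refl) as [k Hk].
        exfalso; exact (H k Hk).
      - intros k Hk; rewrite (proj2 HA (ex_intro _ k Hk)) in H; discriminate. }
    assert (St : forall t, avoids e (t 0) -> exists q y r u,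
      K2 (bpair p t) = Some q /\ delta Q q y /\ g' x y /\
      assoc_computes a (bpair p t) r /\ delta U r u /\ mdom g u /\
      forall s v, delta V s v -> g u v ->
        exists q' y', K1 (bpair q s) = Some q' /\ delta R q' y' /\ f' y y').
    { intros t Ht; apply Av in Ht.
      destruct (A2 t (t 0) eq_refl Ht) as [q [y [Eq [Hq Gy]]]].
      destruct (R1 q y Hq (Df y Gy)) as [r [u [Er [Hu [Du A1]]]]].
      exists q, y, r, u; repeat (split; [assumption|]); split; [|auto].
      apply Ha; unfold pbind; rewrite Eq; exact Er. }
    assert (I : star_instance g e p a).
    { split; [exists n0; apply Av; exact Hn0|]; intros t Ht.
      destruct (St t Ht) as [q [y [r [u T]]]]; exists r, u; tauto. }
    exists (bpair (bpair e p) a), (bpair (bpair e p) a); split.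
    { unfold ppair; rewrite E2; reflexivity. }
    split; [reflexivity|]; split; [apply star_C_N_dom, I|].
    intros w' w <- [e' [p' [a' [t [s [r [Ez [Ew [_ [Ht [Hr [u [v [Hu [Hv Gv]]]]]]]]]]]]]]].
    assert (Ez1 := f_equal bfst Ez); rewrite !bfst_bpair in Ez1.
    assert (e' = e) by (apply (f_equal bfst) in Ez1; rewrite !bfst_bpair in Ez1; auto).
    assert (p' = p) by (apply (f_equal bsnd) in Ez1; rewrite !bsnd_bpair in Ez1; auto).
    assert (a' = a) by (apply (f_equal bsnd) in Ez; rewrite !bsnd_bpair in Ez; auto).
    subst e' p' a' w'.
    destruct (St t Ht) as [q [y [r' [u' [Eq [Hq [Gy [Hr' [Hu' [_ A1]]]]]]]]]].
    rewrite (assoc_computes_functional _ _ _ _ Hr' Hr) in Hu'.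
    rewrite (delta_fun U r u' u Hu' Hu) in A1.
    destruct (A1 s v Hv Gv) as [q' [y' [Eq' [Hq' Fy']]]].
    exists q', y'; split; [|split; [exact Hq'|split; eauto]].
    unfold pbind, ppair, pfst, psnd; rewrite bfst_bpair, !bsnd_bpair, bfst_bpair, Eq; exact Eq'.
Qed.

(** * Baire category *)

Lemma agree_0 p q : agree 0 p q.
Proof. intros i Hi; lia. Qed.

Lemma agree_trans k p q r : agree k p q -> agree k q r -> agree k p r.
Proof. intros H1 H2 i Hi; rewrite H1, H2; auto. Qed.

Lemma agree_le j k p q : j <= k -> agree k p q -> agree j p q.
Proof. intros L H i Hi; apply H; lia. Qed.

Lemma agree_limit (x : nat -> Baire) (k : nat -> nat) :
  (forall n, k n < k (S n)) -> (forall n, agree (k n) (x (S n)) (x n)) ->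
  forall n, agree (k n) (fun i => x (S i) i) (x n).
Proof.
  intros Hk Hx.
  assert (M : forall n m, n <= m -> k n <= k m /\ agree (k n) (x m) (x n)).
  { intros n m L; induction L as [|m L [IH1 IH2]]; [split; [lia|intros i Hi; reflexivity]|].
    split; [specialize (Hk m); lia|].
    exact (agree_trans _ _ _ _ (agree_le _ _ _ _ IH1 (Hx m)) IH2). }
  assert (G : forall n, n <= k n).
  { induction n as [|n IH]; [lia|]; specialize (Hk n); lia. }
  (* Digit [i] of the limit is read from [x (S i)], where it is already final because
     [i < S i <= k (S i)]. *)
  intros n i Hi; destruct (Nat.le_ge_cases (S i) n) as [L|L].
  - symmetry; apply (M (S i) n L); specialize (G (S i)); lia.
  - apply (M n (S i) L); exact Hi.
Qed.

(** If no [D n] contained a cylinder, every cylinder could be shrunk to one missing the closed set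
    [D n]. Doing so for each [n] in turn leads to a limit outside all of them, against the
    covering. *)
Lemma baire_category (D : nat -> Baire -> Prop) :
  (forall p, exists n, D n p) -> (forall n, open_set (fun p => ~ D n p)) ->
  exists n p k, forall q, agree k q p -> D n q.
Proof.
  intros Cov Op; apply NNPP; intro N.
  assert (St : forall n (s : Baire * nat), exists s' : Baire * nat,
    snd s < snd s' /\ agree (snd s) (fst s') (fst s) /\
    forall q, agree (snd s') q (fst s') -> ~ D n q).
  { intros n [p k].
    assert (E : exists q, agree k q p /\ ~ D n q).
    { apply NNPP; intro M; apply N; exists n, p, k; intros q Hq.
      apply NNPP; intro H; apply M; eauto. }
    destruct E as [q [Hq Hn]]; destruct (Op n q Hn) as [m Hm].
    (* [m] keeps the new cylinder off [D n], and [S k] makes the lengths grow strictly. *)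
    exists (q, S k + m); simpl; split; [lia|]; split; [exact Hq|].
    intros q' Hq'; apply Hm; intros i Hi; apply Hq'; lia. }
  pose (next := fun n s => proj1_sig (constructive_indefinite_description _ (St n s))).
  assert (Hn : forall n s, snd s < snd (next n s) /\ agree (snd s) (fst (next n s)) (fst s) /\
    forall q, agree (snd (next n s)) q (fst (next n s)) -> ~ D n q).
  { intros n s; unfold next.
    destruct (constructive_indefinite_description _ (St n s)); assumption. }
  pose (z := nat_rect (fun _ => (Baire * nat)%type) (fun _ => 0, 0) next).
  pose proof (agree_limit (fun n => fst (z n)) (fun n => snd (z n))
    (fun n => proj1 (Hn n (z n))) (fun n => proj1 (proj2 (Hn n (z n))))) as L.
  destruct (Cov (fun i => fst (z (S i)) i)) as [n Dn].
  exact (proj2 (proj2 (Hn n (z n))) _ (L (S n)) Dn).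
Qed.

Lemma clopen_agree p k : clopen (fun q => agree k q p).
Proof.
  split; intros q Hq; exists k; intros q' Hq'.
  - exact (agree_trans _ _ _ _ Hq' Hq).
  - intro H; apply Hq; refine (agree_trans _ _ _ _ _ H).
    intros i Hi; symmetry; apply Hq', Hi.
Qed.

(** * Closed fractals *)

Lemma not_W_le_nowhere {X Y : rep_space} (f : mvf X Y) x :
  mdom f x -> ~ W_le f nowhere.
Proof.
  rewrite W_le_iff; intros Dx [K [H [_ [_ R]]]].
  destruct (delta_surj X x) as [p Hp].
  destruct (R p x Hp Dx) as [_ [u [_ [_ [[v []] _]]]]].
Qed.

(** A restricted space has a subset type as carrier, so even restriction to everything must be
    compared by a reduction. *)
Lemma W_le_mrestrict_full {X Y : rep_space} (f : mvf X Y) A :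
  (forall p, A p) -> W_le f (mrestrict f A).
Proof.
  intro HA; apply W_le_iff; exists psnd, (fun p => Some p).
  split; [exact computable_psnd|split; [exact computable_id|]].
  intros p x Hx Dx; assert (HxA : exists q, A q /\ delta X q x) by eauto.
  exists p, (exist _ x HxA); split; [reflexivity|].
  split; [exact (conj (HA p) Hx)|split; [exact Dx|]].
  intros s v Hv Fv; exists s, v; unfold psnd; rewrite bsnd_bpair; auto.
Qed.

Lemma star_C_N_cylinder {S T U V : rep_space} (h : mvf S T) (g : mvf U V) :
  (forall p, exists x, delta S p x) -> (forall x, mdom h x) ->
  W_le h (star_C_N g) ->
  exists p k, W_le (mrestrict h (fun q => agree k q p)) g.
Proof.
  rewrite W_le_iff; intros Tot Dom [K [H [CK [CH R]]]].
  assert (I : forall p x, delta S p x -> exists e p' a,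
    H p = Some (bpair (bpair e p') a) /\ star_instance g e p' a /\
    forall t s r, avoids e (t 0) -> assoc_computes a (bpair p' t) r -> answer g r s ->
      exists q y, K (bpair p (bpair t s)) = Some q /\ delta T q y /\ h x y).
  { intros p x Hx; destruct (R p x Hx (Dom x)) as [z [z' [E [<- [[w Hw] A]]]]].
    destruct Hw as [e [p' [a [_ [_ [_ [-> [_ [J _]]]]]]]]].
    exists e, p', a; repeat (split; [assumption|]); intros t s r Ht Hr Hs.
    apply (A (bpair t s) (bpair t s) eq_refl); exists e, p', a, t, s, r; auto 10. }
  (* The inputs whose enumeration never lists [n], that is, those for which [n] is a correct
     choice. *)
  pose (D := fun n p => forall z, H p = Some z -> avoids (bfst (bfst z)) n).
  destruct (baire_category D) as [n [p0 [k Hk]]].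
  - intro p; destruct (Tot p) as [x Hx].
    destruct (I p x Hx) as [e [p' [a [E [[[n Hn] _] _]]]]].
    exists n; intros z Ez; rewrite E in Ez; injection Ez as <-.
    rewrite !bfst_bpair; exact Hn.
  - intros n p Hp.
    assert (Ex : exists z j, H p = Some z /\ bfst (bfst z) j = Datatypes.S n).
    { apply NNPP; intro M; apply Hp; intros z Ez j Ej; apply M; eauto. }
    destruct Ex as [z [j [Ez Ej]]]; destruct CH as [c [_ Hc]].
    (* The enumeration is the left half of the left half of [H p], so its entry [j] is digit
       [2 * (2 * j)]. Nearby inputs share this digit, and [H] is defined on them since every
       sequence is a name; hence the complement of [D n] is open. *)
    destruct (assoc_out_continuous _ _ _ _ (Hc p z Ez (2 * (2 * j)))) as [m Hm].
    exists m; intros q Hq Dq; destruct (Tot q) as [x Hx].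
    destruct (I q x Hx) as [e [p' [a [E _]]]].
    apply (Dq _ E j); rewrite <- Ej.
    exact (assoc_out_functional _ _ _ _ _ (Hc q _ E (2 * (2 * j))) (Hm q Hq)).
  - exists p0, k; apply W_le_iff.
    pose (t := fun _ : nat => n).
    (* [t] stands in for the answer of [C_N]: the forward map applies the associate in [H p] to the
       parameter paired with [t], and the backward map puts [t] in front of the answer of [g]. As a
       constant sequence, [t] is computable however [n] was found. *)
    exists (pbind (ppair pfst
                         (ppair (fun _ => Some t) psnd)) K),
      (pbind H (papply psnd
                       (ppair (pbind pfst psnd) (fun _ => Some t)))).
    assert (Ct : total_recursive t) by apply recursive_const.
    split; [|split].
    + auto 10 with computable.
    + auto 10 with computable.
    + intros p [x Hx] [Ap Hp] _; simpl in Hp.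
      destruct (I p x Hp) as [e [p' [a [E [[_ J] A]]]]].
      pose proof (Hk p Ap _ E) as Av; rewrite !bfst_bpair in Av.
      destruct (J t Av) as [r [u [Hr [Hu Du]]]].
      exists r, u; split; [|split; [exact Hu|split; [exact Du|]]].
      * unfold pbind; rewrite E; eapply papply_intro; [reflexivity|reflexivity|].
        cbn; rewrite bfst_bpair, !bsnd_bpair; exact Hr.
      * intros s v Hv Gv; unfold pbind, ppair, pfst, psnd; rewrite bfst_bpair, bsnd_bpair.
        apply (A t s r Av Hr); exists u, v; auto.
Qed.

Theorem theorem13 (X Y U V : rep_space) (f : mvf X Y) (g : mvf U V) :
  closed_fractal f -> W_le_star f g C_N -> W_le f g.
Proof.
  intros [S [T [h [_ [Tot [Dom Fr]]]]]] Hs.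
  pose proof (Hs _ _ _ (fun P Q R f' g' => star_C_N_upper_bound g P Q R f' g')) as Hf.
  assert (Cyl : forall p k,
    W_equiv (mrestrict h (fun q => agree k q p)) f).
  { intros p k; destruct (Fr _ (clopen_agree p k)) as [E|[E _]]; [exact E|exfalso].
    destruct (Tot p) as [x Hx].
    assert (Hp : exists q, agree k q p /\ delta S q x)
      by (exists p; split; [intros i _; reflexivity|exact Hx]).
    exact (not_W_le_nowhere (mrestrict h (fun q => agree k q p))
      (exist _ x Hp) (Dom x) E). }
  assert (Hh : W_le h f).
  { exact (W_le_trans _ _ _ (W_le_mrestrict_full h _ (fun q => agree_0 q (fun _ => 0)))
      (proj1 (Cyl (fun _ => 0) 0))). }
  destruct (star_C_N_cylinder h g Tot Dom (W_le_trans _ _ _ Hh Hf)) as [p [k Hg]].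
  exact (W_le_trans _ _ _ (proj2 (Cyl p k)) Hg).
Qed.
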